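(* Let $n\ge 2$ be a fixed integer and let $$ P(x_1, x_2, \ldots, x_{n+2})=\sum_{i=1}^{n} (x_2-x_1)^{i-1} x_1^{n-i} x_{i+2}. $$ Then there is a constant $c>0$, depending only on $n$, such that for any finite set $A\subset \mathbb{C}$ we have $$ \Bigl|\bigl\{P(x_1,x_2,\ldots,x_{n+2}): \, x_1,\ldots,x_{n+2}\in A\bigr\}\Bigr|\ge c\,|A|^{n}. $$
   Context: $|X|$ denotes the cardinality of a finite set $X$. $P$ is a polynomial in the variables $x_1,\dots,x_{n+2}$ (so zeroth powers are the constant $1$). The variables $x_1,\ldots,x_{n+2}$ range independently over $A$ (repetitions allowed). *)

(* Defs.v *)
From HB Require Import structures.
From mathcomp Require Import all_boot all_order all_algebra.
From mathcomp Require Import finmap complex reals.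

Set Implicit Arguments.
Unset Strict Implicit.
Unset Printing Implicit Defensive.

Import Order.TTheory GRing.Theory Num.Theory.

Local Open Scope ring_scope.

(* The family [x] is 0-indexed, and so is the summation index [i] (shifted down
   by one); the coefficient variable [x_(i+2)] of the 1-indexed formula is thus
   [x (rshift 2 i)], whose index has value [2 + i]. *)
Definition P_eval (K : comNzRingType) (n : nat) (x : 'I_(2 + n) -> K) : K :=
  let x1 := x (@Ordinal (2 + n) 0 isT) in
  let x2 := x (@Ordinal (2 + n) 1 isT) in
  \sum_(i < n) (x2 - x1) ^+ i * x1 ^+ (n - i.+1) * x (rshift 2 i).

(* [A] is coerced to the finite type of its elements, so [x] ranges over all
   families of n + 2 not necessarily distinct elements of [A]. *)
Definition P_image (K : comNzRingType) (n : nat) (A : {fset K}) : {fset K} :=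
  [fset P_eval (fun j => val (x j))
    | x : {ffun 'I_(2 + n) -> A} in predT]%fset.

(* Main.v *)
(* Among pairs of elements of A choose x1 = a and x2 = b with a <> 0, b <> a and
   |t| minimal, where t = (b - a) / a; then |t| <= 2, and by minimality any two
   distinct y, y' in A satisfy |y - y'| >= |t| |y|.  Up to the factor a^(n-1), P
   is now the linear form sum_i t^i y_i in the remaining variables.  Let y_i range
   over a subset B_i of A, of size proportional to |A|, where for i > j the
   diameter of B_i is at most 4^-n times the modulus of every element of B_j.  If
   two families agree up to index j and differ there, the j-th terms differ by at
   least |t|^(j+1) |y_j|, which the later terms cannot compensate, so the form is
   injective on the product of the B_i.  To build the B_i, split at the median of
   the modulus, keep the large elements, cut the disk containing the small ones
   into boundedly many small cells, and iterate inside the most popular cell. *)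

Require Import Defs.
From HB Require Import structures.
From mathcomp Require Import all_boot all_order all_algebra.
From mathcomp Require Import finmap complex reals.
From mathcomp Require Import ring zify.

Set Implicit Arguments.
Unset Strict Implicit.
Unset Printing Implicit Defensive.

Import Order.TTheory GRing.Theory Num.Theory.

Local Open Scope ring_scope.

(** * Large subsets separated in modulus *)

Lemma median_split (K : numDomainType) (T : finType) (f : T -> K)
    (B : {set T}) :
  (forall x, f x \is Num.real) ->
  exists U V : {set T},
    [/\ U \subset B, V \subset B, (#|B| <= 2 * #|U|)%N, (#|B| <= 2 * #|V|)%N
      & {in U & V, forall u v, f v <= f u}].
Proof.
move=> f_real.
case: (set_0Vmem B) => [->|[x0 x0B]].
  by exists set0, set0; rewrite sub0set cards0; split=> // u v; rewrite inE.
have f_realB : {in mem B, forall x, f x \is Num.real} by move=> x _.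
pose up x := [set y in B | f x <= f y].
pose heavy x := (x \in B) && (#|B| <= 2 * #|up x|)%N.
have [x1 heavy_x1] : exists x, heavy x.
  case: (real_arg_minP x0B f_realB) => i iB imin; exists i.
  rewrite /heavy (iB : i \in B) (_ : up i = B); first lia.
  by apply/setP=> y; rewrite inE; case: (boolP (y \in B)) => // /imin.
have f_realH : {in heavy, forall x, f x \is Num.real} by move=> x _.
(* The median is the highest value [f m] that still has at least half of [B] at or above it. *)
case: (real_arg_maxP heavy_x1 f_realH) => m /andP [mB m_heavy] m_max.
pose V := [set y in B | f y <= f m].
exists (up m), V; split=> //; first 1 last.
- by apply/subsetP=> y; rewrite inE => /andP [].
(* If [W] is nonempty and [w] is its lowest element, then [up w = W]; by maximality of [m], [w] is
   not heavy, so [W] is less than half of [B]. *)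
- pose W := [set y in B | f m < f y].
  have cardB : (#|B| = #|V| + #|W|)%N.
    rewrite -(cardsID [set y | f y <= f m] B); congr (#|pred_of_set _| + _)%N.
      by apply/setP=> y; rewrite !inE.
    apply: eq_card => y; rewrite !inE.
    by case: (real_leP (f_real y) (f_real m)) => //= _; rewrite ?andbT ?andbF.
  case: (set_0Vmem W) => [W0|[w0 w0W]].
    by rewrite cardB W0 cards0; lia.
  have f_realW : {in mem W, forall x, f x \is Num.real} by move=> x _.
  case: (real_arg_minP w0W f_realW) => w wW w_min.
  have /andP [wB mw] : (w \in B) && (f m < f w) by have : w \in W := wW; rewrite inE.
  have upw : up w = W.
    apply/setP=> y; rewrite !inE; case: (boolP (y \in B)) => //= yB.
    apply/idP/idP => [|my]; first exact: lt_le_trans.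
    by apply/w_min; have : y \in W by rewrite inE yB.
  have : ~~ heavy w.
    by apply/negP => /m_max wm; have := lt_le_trans mw wm; rewrite ltxx.
  by rewrite /heavy wB upw /=; lia.
- by move=> u v; rewrite !inE => /andP [_ hu] /andP [_ hv]; exact: le_trans hu.
- by apply/subsetP=> y; rewrite inE => /andP [].
Qed.

(** Bisect the interval [k] times, each time keeping the half that holds more points. *)
Lemma interval_pigeonhole (K : numFieldType) (T : finType) (f : T -> K)
    (k : nat) (V : {set T}) (a l : K) :
  (forall x, f x \is Num.real) -> a \is Num.real -> l \is Num.real ->
  {in V, forall x, a <= f x <= a + l} ->
  exists2 W : {set T}, W \subset V & (#|V| <= 2 ^ k * #|W|)%N /\
    {in W &, forall x y, `|f x - f y| * 2 ^+ k <= l}.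
Proof.
move=> f_real; elim: k V a l => [|k IHk] V a l a_real l_real Vl.
  exists V => //; rewrite mul1n; split=> // x y xV yV.
  have /andP [ax xl] := Vl _ xV; have /andP [ay yl] := Vl _ yV.
  rewrite expr0 mulr1 real_ler_norml ?realB // lerBlDr lerBrDr.
  rewrite (le_trans xl) ?andbT; last by rewrite addrC lerD2l.
  by rewrite addrC lerBlDr (le_trans yl) ?lerD2r.
have l2_real : l / 2 \is Num.real by rewrite realM ?realV ?realn.
have al2_real : a + l / 2 \is Num.real by rewrite realD.
pose V1 := [set x in V | f x <= a + l / 2].
pose V2 := [set x in V | a + l / 2 < f x].
have cardV : (#|V| = #|V1| + #|V2|)%N.
  rewrite -(cardsID [set x | f x <= a + l / 2] V).
  congr (#|pred_of_set _| + _)%N; first by apply/setP=> y; rewrite !inE.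
  apply: eq_card => y; rewrite !inE.
  by case: (real_leP (f_real y) al2_real) => //= _; rewrite ?andbT ?andbF.
have [V' [b [b_real V'V cardV' V'b]]] : exists V' : {set T}, exists b,
    [/\ b \is Num.real, V' \subset V, (#|V| <= 2 * #|V'|)%N
      & {in V', forall x, b <= f x <= b + l / 2}].
  case: (leqP #|V2| #|V1|) => cmp.
    exists V1, a; split=> //; first by apply/subsetP=> x; rewrite inE => /andP [].
      by lia.
    by move=> x; rewrite inE => /andP [/Vl /andP [-> _] ->].
  exists V2, (a + l / 2); split=> //.
    by apply/subsetP=> x; rewrite inE => /andP [].
    by lia.
  move=> x; rewrite inE => /andP [/Vl /andP [_ h1] /ltW ->].
  by rewrite -addrA -splitr.
have [W WV' [cardW Wl]] := IHk _ _ _ b_real l2_real V'b.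
exists W; first exact: subset_trans WV' V'V.
split; first by rewrite (leq_trans cardV') // expnS -mulnA leq_mul2l cardW orbT.
move=> x y xW yW; rewrite exprSr mulrA -ler_pdivlMr ?ltr0n //.
exact: Wl.
Qed.

Lemma normC_Im_le (C : numClosedFieldType) (z : C) : `|'Im z| <= `|z|.
Proof.
rewrite -ler_sqr ?nnegrE ?normr_ge0 // (normC2_Re_Im z) real_normK ?Creal_Im //.
by rewrite lerDr -real_normK ?Creal_Re // exprn_ge0.
Qed.

Lemma normC_Re_le (C : numClosedFieldType) (z : C) : `|'Re z| <= `|z|.
Proof. by rewrite leif_normC_Re_Creal. Qed.

Lemma normC_le_ReDIm (C : numClosedFieldType) (z : C) : `|z| <= `|'Re z| + `|'Im z|.
Proof.
by rewrite {1}[z]Crect (le_trans (ler_normD _ _)) // normrM normCi mul1r.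
Qed.

(** The disk lies in a square of side [2 * r]. Bisecting [k] times in each coordinate leaves a cell
    of side [2 * r / 2 ^+ k], and the two sides together bound the distance. *)
Lemma disk_pigeonhole (C : numClosedFieldType) (T : finType) (v : T -> C)
    (k : nat) (V : {set T}) (r : C) :
  r \is Num.real -> {in V, forall x, `|v x| <= r} ->
  exists2 W : {set T}, W \subset V & (#|V| <= 2 ^ (k + k) * #|W|)%N /\
    {in W &, forall x y, `|v x - v y| * 2 ^+ k <= 4 * r}.
Proof.
move=> r_real Vr.
have bound (g : C -> C) : (forall z, g z \is Num.real) ->
    (forall z, `|g z| <= `|z|) ->
    {in V, forall x, - r <= g (v x) <= - r + 2 * r}.
  move=> g_real g_le x xV.
  rewrite (_ : - r + 2 * r = r); last by ring.
  by rewrite -real_ler_norml // (le_trans (g_le _)) ?Vr.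
have r2_real : 2 * r \is Num.real by rewrite realM ?realn.
have nr_real : - r \is Num.real by rewrite realN.
have [V' V'V [cV' hV']] := interval_pigeonhole k
  (fun x => Creal_Re (v x)) nr_real r2_real
    (bound _ (@Creal_Re C) (@normC_Re_le C)).
have boundI : {in V', forall x, - r <= 'Im (v x) <= - r + 2 * r}.
  move=> x /(subsetP V'V).
  exact: (bound _ (@Creal_Im C) (@normC_Im_le C)).
have [W WV' [cW hW]] := interval_pigeonhole k
  (fun x => Creal_Im (v x)) nr_real r2_real boundI.
exists W; first exact: subset_trans WV' V'V.
split.
  by rewrite (leq_trans cV') // expnD -mulnA leq_mul2l cW orbT.
move=> x y xW yW.
apply: le_trans (ler_wpM2r _ (normC_le_ReDIm _)) _; first by rewrite exprn_ge0.
rewrite mulrDl (_ : 4 * r = 2 * r + 2 * r); last by ring.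
by rewrite !raddfB /= lerD ?hW // hV' ?(subsetP WV').
Qed.

(** Split at the median modulus. The smallest modulus in the upper part is the radius of a disk
    containing the lower part, in which a popular cell is then taken. *)
Lemma separated_pair (C : numClosedFieldType) (T : finType) (v : T -> C)
    (k : nat) (B : {set T}) :
  exists U V : {set T}, [/\ U \subset B, V \subset B, (#|B| <= 2 * #|U|)%N,
    (#|B| <= 2 * 2 ^ (k + k) * #|V|)%N &
    forall u x y, u \in U -> x \in V -> y \in V ->
      `|v x - v y| * 2 ^+ k <= 4 * `|v u|].
Proof.
have [U [V [UB VB cU cV UV]]] := median_split B (fun x => normr_real (v x)).
case: (set_0Vmem U) => [U0|[u0 u0U]].
  exists U, V; split=> //; last by move=> u x y; rewrite U0 inE.
  by rewrite (leq_trans cU) // U0 cards0 muln0.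
have f_realU : {in mem U, forall x, `|v x| \is Num.real}.
  by move=> x _; apply: normr_real.
case: (real_arg_minP u0U f_realU) => m mU m_min.
have Vm : {in V, forall x, `|v x| <= `|v m|} by move=> x /(UV m x mU).
have [W WV [cW hW]] := disk_pigeonhole k (normr_real _) Vm.
exists U, W; split=> //; first exact: subset_trans WV VB.
  by rewrite (leq_trans cV) // -mulnA leq_mul2l cW orbT.
move=> u x y uU xW yW; apply: le_trans (hW x y xW yW) _.
by rewrite ler_wpM2l // m_min.
Qed.

Lemma separated_family (C : numClosedFieldType) (T : finType) (v : T -> C)
    (k n : nat) (B : {set T}) :
  exists U : nat -> {set T},
    (forall i, (i < n)%N -> U i \subset B /\
      (#|B| <= (2 * 2 ^ (k + k)) ^ n * #|U i|)%N) /\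
    (forall i j u x y, (j < i < n)%N -> u \in U j -> x \in U i -> y \in U i ->
      `|v x - v y| * 2 ^+ k <= 4 * `|v u|).
Proof.
set M := (2 * _)%N.
have M_ge2 : (2 <= M)%N by rewrite /M leq_pmulr ?expn_gt0.
elim: n B => [|n IHn] B; first by exists (fun=> set0); split=> // i j; lia.
have [U0 [V [U0B VB cU0 cV sep]]] := separated_pair v k B.
have [U [subU sepU]] := IHn V.
(* All later sets live inside the single cell [V], so they inherit its small diameter relative to
   [U0]. *)
exists (fun i => if i is i'.+1 then U i' else U0); split.
  case=> [_|i /subU [UV cU]]; split=> //.
  - rewrite (leq_trans cU0) // leq_mul2r expnS.
    by rewrite (leq_trans M_ge2) ?orbT // leq_pmulr // expn_gt0; lia.
  - exact: subset_trans UV VB.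
  - by rewrite (leq_trans cV) // -/M expnS -[leqRHS]mulnA leq_mul2l cU orbT.
case=> [|i] [|j] u x y ijn //; last exact: sepU.
have [|/subsetP UV _] := subU i; first by lia.
by move=> uU /UV xV /UV yV; apply: sep.
Qed.

(** * Injectivity of the linear form and choice of its ratio *)

Lemma lacunary_sum_eq0 (K : numFieldType) (n : nat) (t : K) (w s : 'I_n -> K) :
  t != 0 -> `|t| <= 2 ->
  (forall j, w j != 0 -> 0 < s j /\ `|t| * s j <= `|w j|) ->
  (forall i j : 'I_n, (j < i)%N -> `|w i| * 4 ^+ n <= s j) ->
  \sum_(i < n) t ^+ i * w i = 0 -> forall i, w i = 0.
Proof.
move=> t0 t2 ws wlt sum0 i0; apply/eqP/negP => /negP wi0.
case: (@arg_minnP _ i0 (fun i => w i != 0) (fun i : 'I_n => i) wi0) => j wj jmin.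
have [sj_gt0 tsw] := ws j wj.
have t_gt0 : 0 < `|t| by rewrite normr_gt0.
have low (i : 'I_n) : (i < j)%N -> w i = 0.
  by move=> ij; apply/eqP/negPn/negP => /jmin; rewrite leqNgt ij.
(* The first nonzero term must cancel the later ones. Of the factor [4 ^+ n], one [2 ^+ n] absorbs
   the surplus powers of [t], as [|t| <= 2]; the other beats the number of terms, as [n < 2 ^ n]. *)
have : `|t ^+ j * w j| < `|t| ^+ j.+1 * s j.
  have -> : t ^+ j * w j = - \sum_(i < n | i != j) t ^+ i * w i.
    by move: sum0; rewrite (bigD1 j) // => /eqP; rewrite addr_eq0 => /eqP.
  rewrite normrN (le_lt_trans (ler_norm_sum _ _ _)) //.
  apply: (@le_lt_trans _ _ (\sum_(i < n) `|t| ^+ j.+1 * (s j / 2 ^+ n))).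
    rewrite big_mkcond /=; apply: ler_sum => i _.
    have rhs_ge0 : 0 <= `|t| ^+ j.+1 * (s j / 2 ^+ n).
      by rewrite mulr_ge0 ?exprn_ge0 ?divr_ge0 ?exprn_ge0 // ltW.
    case: ifP => // ij.
    case: (ltngtP i j) => [/low ->|ji|/val_inj eij]; last by rewrite eij eqxx in ij.
      by rewrite mulr0 normr0.
    rewrite normrM normrX -(subnKC ji) exprD -mulrA ler_pM2l ?exprn_gt0 //.
    rewrite ler_pdivlMr ?exprn_gt0 //.
    apply: le_trans (wlt i j ji).
    rewrite (_ : 4 = 2 * 2 :> K); last by ring.
    rewrite exprMn mulrA ler_pM2r ?exprn_gt0 // mulrC ler_wpM2l //.
    apply: (@le_trans _ _ (2 ^+ (i - j.+1))).
      by rewrite lerXn2r ?nnegrE.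
    by rewrite ler_eXn2l ?ltr1n //; have := ltn_ord i; lia.
  rewrite sumr_const card_ord -mulrnAr ltr_pM2l ?exprn_gt0 //.
  rewrite -mulr_natr -mulrA gtr_pMr // mulrC ltr_pdivrMr ?exprn_gt0 //.
  by rewrite mul1r -natrX ltr_nat ltn_expl.
rewrite normrM normrX exprSr -mulrA ltr_pM2l ?exprn_gt0 //.
by move=> /(le_lt_trans tsw); rewrite ltxx.
Qed.

Lemma P_eval_factor (K : fieldType) (n : nat) (x : 'I_(2 + n) -> K) (a b : K) :
  x (@Ordinal (2 + n) 0 isT) = a -> x (@Ordinal (2 + n) 1 isT) = b -> a != 0 ->
  P_eval x =
    a ^+ n.-1 * \sum_(i < n) ((b - a) / a) ^+ i * x (rshift 2 i).
Proof.
move=> xa xb a0; rewrite /P_eval xa xb big_distrr /=; apply: eq_bigr => i _.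
have -> : n.-1 = (n - i.+1 + i)%N by have := ltn_ord i; lia.
rewrite exprD expr_div_n mulrA; congr (_ * _).
by rewrite mulrC -!mulrA; congr (_ * _); rewrite mulrC mulfVK ?expf_neq0.
Qed.

(** Take a pair of least ratio: comparing it with [(y, y')] gives the separation. Two distinct
    elements, the one of larger modulus first, already have ratio at most 2. *)
Lemma min_ratio_pair (K : numFieldType) (T : finType) (v : T -> K) :
  injective v -> (1 < #|T|)%N ->
  exists a b, [/\ v a != 0, a != b, `|(v b - v a) / v a| <= 2 &
    forall y y', v y != 0 -> y != y' ->
      `|(v b - v a) / v a| * `|v y| <= `|v y - v y'|].
Proof.
move=> v_inj /card_gt1P [p [q [_ _ pq]]].
pose ratio (c : T * T) := `|(v c.2 - v c.1) / v c.1|.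
pose ok (c : T * T) := (v c.1 != 0) && (c.1 != c.2).
have [c okc c2] : exists2 c, ok c & ratio c <= 2.
  wlog qp : p q pq / `|v q| <= `|v p|.
    case/orP: (real_leVge (normr_real (v q)) (normr_real (v p))) => h wl.
      exact: (wl p q).
    by apply: (wl q p) => //; rewrite eq_sym.
  have p0 : v p != 0.
    apply: contra pq => /eqP p0; move: qp; rewrite p0 normr0 normr_le0 => /eqP q0.
    by apply/eqP/v_inj; rewrite p0 q0.
  exists (p, q); first by rewrite /ok p0.
  rewrite /ratio normrM normfV ler_pdivrMr ?normr_gt0 //=.
  rewrite (le_trans (ler_normB _ _)) //.
  by rewrite mulrDl mul1r lerD2r.
have ratio_real : {in ok, forall c, ratio c \is Num.real}.
  by move=> ? _; apply: normr_real.
case: (real_arg_minP okc ratio_real) => [[a b] /andP [a0 ab] minab].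
exists a, b; split=> //; first exact: le_trans (minab _ okc) c2.
move=> y y' y0 yy'; have /minab : ok (y, y') by rewrite /ok y0.
by rewrite /ratio /= [leRHS]normrM normfV ler_pdivlMr ?normr_gt0 // (distrC (v y)).
Qed.

(** * Counting the values of the polynomial *)

Lemma card_P_image (C : numClosedFieldType) (n : nat) (A : {fset C}) :
  (0 < n)%N ->
  (#|` A| ^ n <= (2 * (2 * 2 ^ (2 * n + 2 + (2 * n + 2))) ^ n) ^ n
                 * #|` P_image n A|)%N.
Proof.
(* Here [2 ^ k = 4 ^ n * 4]: the last 4 cancels the constant of [separated_family], leaving the gap
   [4 ^ n] needed for injectivity. *)
move=> n_gt0; set k := (2 * n + 2)%N; set M := ((2 * 2 ^ (k + k)) ^ n)%N.
have M_gt0 : (0 < M)%N by rewrite expn_gt0 muln_gt0 expn_gt0.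
have N_gt0 : (0 < (2 * M) ^ n)%N by rewrite expn_gt0 muln_gt0 M_gt0.
have P_imageE (x : {ffun 'I_(2 + n) -> A}) : P_eval (fun j => val (x j)) \in P_image n A.
  by apply/imfsetP; exists x.
rewrite cardfE.
case: (posnP #|{: A}|) => [->|A_gt0]; first by rewrite exp0n.
have [p _] := card_gt0P A_gt0.
have im_gt0 : (0 < #|` P_image n A|)%N.
  by rewrite cardfs_gt0; apply/fset0Pn; eexists; apply: (P_imageE [ffun=> p]).
case: (leqP #|{: A}| 1) => [A_le1|A_gt1].
  have -> : #|{: A}| = 1%N by lia.
  by rewrite exp1n muln_gt0 N_gt0.
have [a [b [a0 ab t2 tmin]]] := min_ratio_pair (@val_inj _ _ A) A_gt1.
set t := (_ / _) in t2 tmin.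
have t0 : t != 0.
  rewrite mulf_neq0 ?invr_eq0 // subr_eq0.
  by apply: contra ab => /eqP /val_inj ->.
(* The separation from [tmin] is only available at nonzero points; dropping 0 costs at most a factor
   2 because [A] has at least two elements. *)
pose B := [set x : A | val x != 0].
have cardB : (#|{: A}| <= 2 * #|B|)%N.
  have : (#|~: B| <= 1)%N.
    apply/card_le1_eqP => x y; rewrite !inE !negbK => /eqP x0 /eqP y0.
    by apply: val_inj; rewrite /= x0 y0.
  by move: A_gt1; rewrite -(cardsC B); lia.
have [U [subU sepU]] := separated_family (@fsval _ A) k n B.
pose F (i : 'I_n) : pred A := mem (U i).
pose fam := [set g : {ffun 'I_n -> A} | g \in family F].
pose ext (g : {ffun 'I_n -> A}) : {ffun 'I_(2 + n) -> A} :=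
  [ffun i => match split i with
             | inl j => if j == ord0 then a else b
             | inr j => g j
             end].
pose E g := P_eval (fun j => val (ext g j)).
have EE g : E g = val a ^+ n.-1 * \sum_(i < n) t ^+ i * val (g i).
  rewrite /E (@P_eval_factor _ _ _ (val a) (val b)) //; last 2 first.
  - by rewrite ffunE; case: splitP => [[[|m] ?]|m] //=; lia.
  - by rewrite ffunE; case: splitP => [[[|m] ?]|m] //=; lia.
  congr (_ * _); apply: eq_bigr => i _; congr (_ * _).
  by rewrite ffunE (unsplitK (inr i)).
have E_inj : {in fam &, injective E}.
  move=> g g'; rewrite !inE => /familyP gF /familyP g'F; rewrite !EE.
  move/mulfI => /(_ (expf_neq0 _ a0)) /eqP; rewrite -subr_eq0 -sumrB => /eqP sum0.
  (* Minimality of [|t|] gives the lower bound on nonzero differences, and the small diameter of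
     [U i] gives the gap condition. *)
  have w0 := @lacunary_sum_eq0 _ n t (fun i => val (g i) - val (g' i))
    (fun i => `|val (g i)|) t0 t2.
  apply/ffunP => i; apply/val_inj/eqP; rewrite -subr_eq0; apply/eqP/w0 => {i w0}.
  - move=> j; rewrite subr_eq0 => gj.
    have gj0 : val (g j) != 0.
      have [/subsetP UB _] := subU j (ltn_ord j).
      by have := UB _ (gF j); rewrite inE.
    by rewrite normr_gt0 tmin //; apply: contra gj => /eqP ->.
  - move=> i j ji.
    have := sepU i j (g j) (g i) (g' i); rewrite ji ltn_ord => /(_ isT).
    move/(_ (gF j) (gF i) (g'F i)).
    rewrite /k exprD exprM (_ : 2 ^+ 2 = 4); last by rewrite -natrX.
    by rewrite mulrA mulrC ler_pM2l.
  - by rewrite -[RHS]sum0; apply: eq_bigr => i _; rewrite mulrBr.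
have : ([fset E g | g in fam] `<=` P_image n A)%fset.
  by apply/fsubsetP => _ /imfsetP [g _ ->]; apply: P_imageE.
move/fsubset_leq_card; rewrite card_in_imfset //= -cardE => cardfam.
(* In each coordinate, passing from [A] to [B] loses a factor 2 and from [B] to [U i] a factor
   [M]. *)
have : (#|{: A}| ^ n <= (2 * M) ^ n * #|fam|)%N.
  have -> : #|fam| = (\prod_(i < n) #|U i|)%N.
    by rewrite cardsE card_family foldrE big_map big_enum.
  have expE m : (m ^ n = \prod_(i < n) m)%N by rewrite prod_nat_const card_ord.
  rewrite !expE -big_split /=.
  apply: leq_prod => i _; rewrite (leq_trans cardB) // -mulnA leq_mul2l.
  by have [_] := subU i (ltn_ord i).
by move/leq_trans; apply; rewrite leq_mul2l cardfam orbT.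
Qed.

Theorem theorem1 (R : realType) (n : nat) (n_ge2 : (2 <= n)%N) :
  exists2 c : R, 0 < c &
    forall A : {fset R[i]},
      c * (#|` A|%fset ^ n)%:R <= (#|` P_image n A|%fset)%:R.
Proof.
set N := ((2 * (2 * 2 ^ (2 * n + 2 + (2 * n + 2))) ^ n) ^ n)%N.
have N_gt0 : (0 < N)%N by rewrite !(expn_gt0, muln_gt0).
exists N%:R^-1; first by rewrite invr_gt0 ltr0n.
move=> A; rewrite mulrC ler_pdivrMr ?ltr0n // -natrM ler_nat mulnC.
by apply: card_P_image; apply: ltnW.
Qed.
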